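(* Let $K$ be a field of characteristic zero, let $s,t\in K$, and let $p,q\in K$ (or in an extension) be the roots of $z^2=s z+t$, assumed nonzero, distinct, with $p/q$ not a root of unity. Define $U_n=\frac{p^n-q^n}{p-q}$ and $V_n=p^n+q^n$ for $n\ge0$, and for integers $r,m\ge0$ define the $V$-mixed-$U$ binomial coefficient $$\binom{r+m}{r,m}_{\langle\cdot\rangle/\{\cdot\}}=\frac{V_{r+m}!}{V_r!\,U_m!},$$ where $V_n!=V_nV_{n-1}\cdots V_1$, $U_n!=U_nU_{n-1}\cdots U_1$, $V_0!=U_0!=1$. Then for integers $r,m\ge1$, the identity $$V_{r+m}=U_{m+1}V_r+t\,V_{r-1}U_m$$ is equivalent to $$\binom{r+m}{r,m}_{\langle\cdot\rangle/\{\cdot\}}=U_{m+1}\binom{r+m-1}{r-1,m}_{\langle\cdot\rangle/\{\cdot\}}+t\,V_{r-1}\binom{r+m-1}{r,m-1}_{\langle\cdot\rangle/\{\cdot\}}.$$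
   Context: $U$ and $V$ are the Lucas sequences of the first and second kind associated with $z^2=sz+t$ (so $p+q=s$, $pq=-t$, $U_0=0$, $U_1=1$, $V_0=2$, $V_1=s$). The letter $m$ replaces the paper's second index $s$ to avoid clash with the coefficient $s$. *)

(* Defs.v *)
From HB Require Import structures.
From mathcomp Require Import all_boot all_order all_algebra.

Set Implicit Arguments.
Unset Strict Implicit.
Unset Printing Implicit Defensive.

Import GRing.Theory.
Local Open Scope ring_scope.

Definition lucasU (L : fieldType) (p q : L) (n : nat) : L :=
  (p ^+ n - q ^+ n) / (p - q).

Definition lucasV (L : fieldType) (p q : L) (n : nat) : L := p ^+ n + q ^+ n.

(* The product starts at index 1, so seqfact a 0 = 1. *)
Definition seqfact (L : fieldType) (a : nat -> L) (n : nat) : L :=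
  \prod_(1 <= i < n.+1) a i.

(* The top index of the V-mixed-U binomial coefficient is always the sum r + m
   of the two bottom ones, so only r and m are passed. *)
Definition VUbinom (L : fieldType) (p q : L) (r m : nat) : L :=
  seqfact (lucasV p q) (r + m)
    / (seqfact (lucasV p q) r * seqfact (lucasU p q) m).

(* Main.v *)
Require Import Defs.
From HB Require Import structures.
From mathcomp Require Import all_boot all_order all_algebra.
From mathcomp Require Import ring.

Set Implicit Arguments.
Unset Strict Implicit.
Unset Printing Implicit Defensive.

Import GRing.Theory.
Local Open Scope ring_scope.

(** The binomial identity is the [V]-identity multiplied by [c = V_{r+m-1}! / (V_r! U_m!)]: in each
    binomial, peeling the last factor off the relevant factorials leaves [c] times [V_{r+m}], [V_r]
    or [U_m]. The equivalence is thus cancellation of [c], legitimate because no [U_n] or [V_n] with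
    [n > 0] vanishes ([lucasU_neq0], [lucasV_neq0]), [p / q] not being a root of unity. *)

Lemma seqfactS (L : fieldType) (a : nat -> L) (n : nat) :
  seqfact a n.+1 = seqfact a n * a n.+1.
Proof. by rewrite /seqfact big_nat_recr. Qed.

Lemma seqfact_neq0 (L : fieldType) (a : nat -> L) (n : nat) :
  (forall i, (0 < i)%N -> a i != 0) -> seqfact a n != 0.
Proof.
move=> a_neq0; elim: n => [|n IHn]; first by rewrite /seqfact big_geq ?oner_neq0.
by rewrite seqfactS mulf_neq0 ?a_neq0.
Qed.

Section NonUnityRatio.

Variables (L : fieldType) (p q : L).
Hypothesis q_neq0 : q != 0.
Hypothesis pq_not_unity :
  forall n : nat, (0 < n)%N -> ~~ n.-unity_root (p / q).

Lemma expr_neq_of_not_unity n : (0 < n)%N -> p ^+ n != q ^+ n.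
Proof.
move=> n_gt0; apply/negP => /eqP pqn; have /negP[] := pq_not_unity n_gt0.
by apply/unity_rootP; rewrite expr_div_n pqn divff // expf_neq0.
Qed.

Lemma lucasU_neq0 n : (0 < n)%N -> lucasU p q n != 0.
Proof.
(* The case [n = 1] handles the denominator [p - q], as [p ^+ 1] is convertible to [p]. *)
move=> n_gt0; have p_neq_q := @expr_neq_of_not_unity 1 isT.
by rewrite mulf_neq0 ?invr_eq0 ?subr_eq0 // expr_neq_of_not_unity.
Qed.

(** If [p ^+ n = - q ^+ n], squaring gives [p ^+ (n * 2) = q ^+ (n * 2)], so [p / q] would be a root
    of unity. *)
Lemma lucasV_neq0 n : (0 < n)%N -> lucasV p q n != 0.
Proof.
move=> n_gt0; rewrite /lucasV addr_eq0; apply/negP => /eqP pqn.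
have /negP[] : p ^+ (n * 2) != q ^+ (n * 2).
  by rewrite expr_neq_of_not_unity ?muln_gt0 ?n_gt0.
by rewrite !exprM pqn sqrrN.
Qed.

End NonUnityRatio.

(* The extension of K in which the roots p and q live is given by a field
   morphism iota : K -> L; the case p, q \in K is L = K, iota = idfun. *)
Theorem mainTheorem3 (K L : fieldType) (iota : {rmorphism K -> L})
    (charK0 : [pchar K] =i pred0) (s t : K) (p q : L)
    (root_p : p ^+ 2 = iota s * p + iota t)
    (root_q : q ^+ 2 = iota s * q + iota t)
    (p_neq0 : p != 0) (q_neq0 : q != 0) (p_neq_q : p != q)
    (pq_not_unity : forall n : nat, (0 < n)%N -> ~~ n.-unity_root (p / q))
    (r m : nat) (r_ge1 : (1 <= r)%N) (m_ge1 : (1 <= m)%N) :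
  lucasV p q (r + m) =
    lucasU p q m.+1 * lucasV p q r + iota t * lucasV p q r.-1 * lucasU p q m
  <->
  VUbinom p q r m =
    lucasU p q m.+1 * VUbinom p q r.-1 m
    + iota t * lucasV p q r.-1 * VUbinom p q r m.-1.
Proof.
have V_neq0 := lucasV_neq0 q_neq0 pq_not_unity.
have U_neq0 := lucasU_neq0 q_neq0 pq_not_unity.
case: r r_ge1 => // r' _; case: m m_ge1 => // m' _.
rewrite /VUbinom /= !addSn !addnS !seqfactS.
have := V_neq0 r'.+1 isT; have := U_neq0 m'.+1 isT.
have := seqfact_neq0 r' V_neq0; have := seqfact_neq0 m' U_neq0.
(* This is the numerator of [c]; dividing by [c] requires it to be nonzero as well as the
   denominators. *)
have : seqfact (lucasV p q) (r' + m').+1 != 0 by exact: seqfact_neq0.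
rewrite !seqfactS.
set N := _ * lucasV p q (r' + m').+1; set Vr := seqfact _ r'.
set Um := seqfact _ m'; set u := lucasU p q m'.+1; set v := lucasV p q r'.+1.
set w := lucasU _ _ _; set x := lucasV p q r'; set V := lucasV p q _.+2.
(* From here on only the nonvanishing of these quantities matters, so they become opaque atoms for
   [field]. *)
clearbody N Vr Um u v w x V => N_neq0 Um_neq0 Vr_neq0 u_neq0 v_neq0.
pose c := N / (Vr * v * (Um * u)).
have c_neq0 : c != 0 by rewrite /c mulf_neq0 ?invr_eq0 ?mulf_neq0.
have -> : N * V / (Vr * v * (Um * u)) = c * V by rewrite /c mulrAC.
(* Lowering [r] drops [v] from the denominator and lowering [m] drops [u]; these reappear as factors
   beside [c]. *)
have -> : w * (N / (Vr * (Um * u))) + iota t * x * (N / (Vr * v * Um))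
          = c * (w * v + iota t * x * u).
  by rewrite /c; field; rewrite Um_neq0 Vr_neq0 u_neq0 v_neq0.
by split=> [-> // | /(mulfI c_neq0)].
Qed.
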